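(* Let $D\geq 3$. Let $\omega_{\mathrm{NLO}}$ denote the smallest strictly positive value taken by the degree $\omega$ on connected closed $(D+1)$-colored graphs. Then the core graphs of degree $\omega_{\mathrm{NLO}}$ (the next-to-leading-order core graphs) are exactly the graphs $\mathcal G_{2\text{-dipole}}^{\{i_0,i_1\}}$, where $\{i_0,i_1\}$ ranges over the two-element subsets of $\{0,\dots,D\}$ (up to isomorphism of colored graphs).
   Context: A closed $(D+1)$-colored graph is a finite bipartite multigraph (vertices black or white, every edge joins a black to a white vertex) in which every vertex has exactly $D+1$ incident edges, carrying each of the colors $0,\dots,D$ exactly once. Isomorphisms preserve edge colors and vertex colors. Write $2p$ for the number of vertices of $\mathcal G$. A $k$-bubble of species $\{j_0,\dots,j_{k-1}\}$ is a connected component of the subgraph formed by all vertices and the edges with colors in $\{j_0,\dots,j_{k-1}\}$. Faces are the 2-bubbles; $|\mathcal F_{\mathcal G}|$ is their total number. The notation $\{\widehat i\}$ means $\{0,\dots,D\}\setminus\{i\}$. The degree of a connected closed graph is $$\omega(\mathcal G)=\frac{(D-1)!}{2}\Big(D+\frac{D(D-1)}{2}p-|\mathcal F_{\mathcal G}|\Big),$$ which is always a non-negative integer. A 1-dipole of species $\{i\}$ consists of a black and a white vertex joined by an edge of color $i$ and lying in two distinct $D$-bubbles of species $\{\widehat i\}$. Annihilating it means deleting the two vertices and the edge of color $i$ and, for each color $j\ne i$, joining the two resulting half-edges of color $j$ into one edge. A core graph is a connected closed $(D+1)$-colored graph that contains no 1-dipole (equivalently, it has exactly one $D$-bubble of species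 $\{\widehat i\}$ for every color $i$). For two distinct colors $i_0,i_1$, the graph $\mathcal G_{2\text{-dipole}}^{\{i_0,i_1\}}$ has two black vertices $v_1,v_2$ and two white vertices $\bar v_1,\bar v_2$; for every color $j\notin\{i_0,i_1\}$ the edges of color $j$ are $v_1\bar v_1$ and $v_2\bar v_2$; for $j\in\{i_0,i_1\}$ the edges of color $j$ are $v_1\bar v_2$ and $v_2\bar v_1$. *)

(* Defs.v *)
From HB Require Import structures.
From mathcomp Require Import all_boot all_order all_algebra.

Set Implicit Arguments.
Unset Strict Implicit.
Unset Printing Implicit Defensive.

Import Order.TTheory GRing.Theory Num.Theory.
Local Open Scope ring_scope.

(* Closed (D+1)-colored graph. Bipartiteness is built in: every edge has one
   black and one white endpoint; parallel edges are allowed. *)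
Record colored_graph (D : nat) := ColoredGraph {
  black : finType;
  white : finType;
  edge : finType;
  bend : edge -> black;
  wend : edge -> white;
  color : edge -> 'I_D.+1;
  black_regular : forall (b : black) (i : 'I_D.+1),
    #|[set e | (bend e == b) && (color e == i)]| = 1%N;
  white_regular : forall (w : white) (i : 'I_D.+1),
    #|[set e | (wend e == w) && (color e == i)]| = 1%N
}.

Section Graph.

Variables (D : nat) (G : colored_graph D).

Definition vertex : finType := (black G + white G)%type.

Definition bvertex (e : edge G) : vertex := inl (bend e).
Definition wvertex (e : edge G) : vertex := inr (wend e).

Definition adj (S : {set 'I_D.+1}) : rel vertex := fun u v =>
  [exists e : edge G, (color e \in S) &&
    (((u == bvertex e) && (v == wvertex e)) ||
     ((u == wvertex e) && (v == bvertex e)))].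

(* A bubble of species S is represented by its vertex set. *)
Definition bubbles (S : {set 'I_D.+1}) : {set {set vertex}} :=
  equivalence_partition (connect (adj S)) [set: vertex].

(* Bubbles of different species are different even if they have the same
   vertices, hence the sum over species. *)
Definition nfaces : nat :=
  (\sum_(S : {set 'I_D.+1} | #|S| == 2) #|bubbles S|)%N.

(* There is exactly one component, so the empty graph is excluded. *)
Definition connected : Prop := #|bubbles [set: 'I_D.+1]| = 1%N.

(* The number p, where the graph has 2p vertices. *)
Definition half_order : nat := #|vertex|./2.

Definition degree : rat :=
  (D.-1)`!%:R / 2 *
    (D%:R + (D%:R * (D%:R - 1)) / 2 * half_order%:R - nfaces%:R).

(* The edge e and its endpoints form a 1-dipole of species {color e}. *)
Definition is_1dipole (e : edge G) : Prop :=
  ~~ connect (adj (~: [set color e])) (bvertex e) (wvertex e).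

Definition core : Prop := connected /\ ~ (exists e : edge G, is_1dipole e).

End Graph.

Definition isomorphic (D : nat) (G H : colored_graph D) : Prop :=
  exists (fb : black G -> black H) (fw : white G -> white H)
         (fe : edge G -> edge H),
    [/\ bijective fb, bijective fw & bijective fe] /\
    (forall e : edge G,
       [/\ bend (fe e) = fb (bend e), wend (fe e) = fw (wend e)
         & color (fe e) = color e]).

Definition is_NLO_degree (D : nat) (w : rat) : Prop :=
  [/\ 0 < w,
      exists G : colored_graph D, connected G /\ degree G = w
    & forall G : colored_graph D, connected G -> 0 < degree G -> w <= degree G].

Section TwoDipole.

Variables (D : nat) (i0 i1 : 'I_D.+1).

(* Both color classes of vertices are indexed by bool, and the edge (b, i) is
   the edge of color i at the black vertex b. *)
Definition two_dipole_wend (e : bool * 'I_D.+1) : bool :=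
  if e.2 \in [set i0; i1] then ~~ e.1 else e.1.

Lemma two_dipole_black_regular (b : bool) (i : 'I_D.+1) :
  #|[set e : bool * 'I_D.+1 | (e.1 == b) && (e.2 == i)]| = 1%N.
Proof.
rewrite -(cards1 (b, i)); congr #|pred_of_set _|.
by apply/setP => -[c j]; rewrite !inE xpair_eqE.
Qed.

Lemma two_dipole_white_regular (w : bool) (i : 'I_D.+1) :
  #|[set e : bool * 'I_D.+1 | (two_dipole_wend e == w) && (e.2 == i)]| = 1%N.
Proof.
rewrite -(cards1 (two_dipole_wend (w, i), i)); congr #|pred_of_set _|.
apply/setP => -[c j]; rewrite !inE xpair_eqE /two_dipole_wend /=.
case: (j =P i) => [->|_]; last by rewrite !andbF.
by rewrite !andbT; case: (i \in _); case: c; case: w.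
Qed.

Definition two_dipole_graph : colored_graph D :=
  ColoredGraph two_dipole_black_regular two_dipole_white_regular.

End TwoDipole.

(* Main.v *)
(* Let p be the number of black vertices. Identifying white with black vertices
   along color 0, color k becomes a permutation s_k of the p black vertices, and
   p - #(faces of colors k, l) is the Cayley distance d(k, l) of s_k and s_l. So the
   degree is, up to the factor (D-1)!/2, the number
     Delta = sum_(k < l) d(k, l) - D (p - C),
   which we consider for any number C of components. Riemann-Hurwitz for cyclic walks
   through all the colors (jackets), averaged over the cyclic orders, gives Delta >= 0.

   If Delta < D and p > C, counting the pairs of non-parallel edges at the white
   vertices yields a vertex z having a bundle of at least D - 1 parallel edges,
   ending at a say (or else D = 5 and the edges at z form two bundles of three).
   Take a color i outside this bundle, whose edge at z ends at y, and exchange a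
   and y as ends of edges of color i. This changes each d(k, i) by 1, downwards if k
   is in the bundle. If all d(k, i) decrease, the new Delta is Delta - D + D (C' - C);
   it is non-negative, so C' = C + 1 and Delta is unchanged. Otherwise C' <= C and
   Delta drops by at least D - 2. Induction on sum d shows that Delta = 0 or
   Delta >= D - 2.

   In a core graph the other colors stay connected after the exchange, so the first
   case is impossible; if Delta = D - 2, the exchange gives a connected graph with
   Delta = 0. Almost all its subgraphs omitting one color are still connected, and
   summing their Riemann-Hurwitz bounds gives p <= 2. *)

Require Import Defs.
From mathcomp Require Import all_boot all_order all_algebra.
From mathcomp Require Import fingroup perm.
From mathcomp Require Import zify ring lra.

Set Implicit Arguments.
Unset Strict Implicit.
Unset Printing Implicit Defensive.

(** * Components of relations *)

(** On [A] the map [g] factors through [h]. This compares numbers of classes without exhibiting a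
    map between partitions. *)
Lemma leq_card_imset_ker (T U V : finType) (g : T -> U) (h : T -> V) (A : {set T}) :
    {in A &, forall x y, h x = h y -> g x = g y} ->
  #|g @: A| <= #|h @: A|.
Proof.
move=> ker_hg.
pose pre v := [pick x in A | h x == v].
have Some_injective : injective (@Some U) by move=> ? ? [].
rewrite -(card_imset _ Some_injective).
suff sub : [set Some u | u in g @: A] \subset [set omap g (pre v) | v in h @: A].
  exact: leq_trans (subset_leq_card sub) (leq_imset_card _ _).
apply/subsetP => _ /imsetP[_ /imsetP[x Ax ->] ->]; apply/imsetP; exists (h x).
  exact: imset_f.
rewrite /pre; case: pickP => [y /andP[Ay /eqP hy]|/(_ x)]; last by rewrite Ax eqxx.
by congr Some; apply: ker_hg.
Qed.

(** Same shape as [bubbles], so that the number of bubbles of species [S] is [ncomp (adj S)] by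
    conversion. *)
Definition ncomp (T : finType) (r : rel T) : nat :=
  #|equivalence_partition (connect r) [set: T]|.

Section Components.

Variables (T : finType).
Implicit Types (r : rel T) (s : {perm T}) (x y z : T).

Let cl r x := [set y in [set: T] | connect r x y].

Let clP r x y : connect_sym r -> reflect (cl r x = cl r y) (connect r x y).
Proof.
move=> sym_r; apply: (iffP idP) => [xy|/setP/(_ y)].
  by apply/setP => z; rewrite !inE; exact: same_connect.
by rewrite !inE /= connect0.
Qed.

Lemma ncomp_le r : ncomp r <= #|T|.
Proof. by rewrite -cardsT leq_imset_card. Qed.

Lemma ncomp_gt0 r x : 0 < ncomp r.
Proof. by apply/card_gt0P; exists (cl r x); apply: imset_f. Qed.

Lemma ncomp_sub r1 r2 :
  connect_sym r1 -> connect_sym r2 -> subrel r1 (connect r2) -> ncomp r2 <= ncomp r1.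
Proof.
move=> sym1 sym2 sub12; apply: leq_card_imset_ker => x y _ _ /(clP _ _ sym1) xy.
by apply/clP => //; apply: (connect_sub sub12).
Qed.

Definition add_edge r x y : rel T :=
  fun a b => [|| r a b, (a == x) && (b == y) | (a == y) && (b == x)].

Lemma add_edge_sym r x y : symmetric r -> symmetric (add_edge r x y).
Proof. by move=> sym_r a b; rewrite /add_edge sym_r; congr orb; rewrite orbC andbC [X in _ || X]andbC. Qed.

Lemma connect_add_edge r x y a b : connect_sym r ->
  connect (add_edge r x y) a b =
  [|| connect r a b, connect r a x && connect r y b | connect r a y && connect r x b].
Proof.
move=> sym_r; apply/idP/idP; last first.
  have sub : subrel (connect r) (connect (add_edge r x y)).
    by apply: connect_sub => u v uv; apply/connect1/orP; left.
  have xy : connect (add_edge r x y) x y by apply: connect1; rewrite /add_edge !eqxx orbT.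
  have yx : connect (add_edge r x y) y x by apply: connect1; rewrite /add_edge !eqxx !orbT.
  case/or3P => [|/andP[ax yb]|/andP[ay xb]]; first exact: sub.
    exact: connect_trans (sub _ _ ax) (connect_trans xy (sub _ _ yb)).
  exact: connect_trans (sub _ _ ay) (connect_trans yx (sub _ _ xb)).
case/connectP => p; elim: p a => [a _ ->|c p IH a /= /andP[ac /IH cb /cb{cb}]]; first by rewrite connect0.
case/or3P: ac => [ac|/andP[/eqP-> /eqP->]|/andP[/eqP-> /eqP->]] cb.
- have ac' := connect1 ac.
  have L z : connect r c z -> connect r a z by apply: connect_trans.
  by case/or3P: cb => [/L->|/andP[/L-> ->]|/andP[/L-> ->]]; rewrite ?orbT.
- rewrite !connect0 /=; case/or3P: cb => [->|/andP[_ ->]|/andP[_ ->]]; by rewrite ?orbT.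
- rewrite !connect0 /=; case/or3P: cb => [->|/andP[_ ->]|/andP[_ ->]]; by rewrite ?orbT.
Qed.

Lemma ncomp_add_edge r x y : symmetric r ->
  ncomp r <= ncomp (add_edge r x y) + ~~ connect r x y.
Proof.
move=> sr; have sym_r := sym_connect_sym sr.
have sym2 := sym_connect_sym (add_edge_sym x y sr).
case: (boolP (connect r x y)) => [xy|nxy].
  rewrite addn0; apply: leq_card_imset_ker => a b _ _ /(clP _ _ sym2) ab; apply/clP => //.
  move: ab; rewrite connect_add_edge // => /or3P[//|/andP[ax yb]|/andP[ay xb]].
    exact: connect_trans ax (connect_trans xy yb).
  by apply: connect_trans ay (connect_trans _ xb); rewrite sym_r.
(* The class of [y] is set aside: the new edge merges no two of the remaining classes. *)
pose A := [set z | ~~ connect r z y].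
have -> : ncomp r = #|cl r @: [set: T]| by [].
have sub : cl r @: [set: T] \subset cl r y |: cl r @: A.
  apply/subsetP => _ /imsetP[z _ ->]; rewrite !inE; case: (boolP (connect r z y)) => [zy|nzy].
    by apply/orP; left; apply/eqP/clP.
  by apply/orP; right; apply: imset_f; rewrite inE.
apply: leq_trans (subset_leq_card sub) _; rewrite cardsU1 addnC leq_add ?leq_b1 //.
have subA : cl (add_edge r x y) @: A \subset cl (add_edge r x y) @: [set: T] by exact/imsetS/subsetT.
apply: leq_trans (subset_leq_card subA); apply: leq_card_imset_ker => a b.
rewrite !inE => nay nby /(clP _ _ sym2); rewrite connect_add_edge // => ab; apply/clP => //.
by case/or3P: ab => // /andP[]; rewrite 1?(sym_r y b) (negbTE nay, negbTE nby).
Qed.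

Lemma ncomp_rel0 : ncomp (fun _ _ : T => false) = #|T|.
Proof.
rewrite /ncomp /equivalence_partition card_imset ?cardsT // => x y /setP/(_ y).
rewrite !inE connect0 => /connectP[[|z p] //= _ ->//].
Qed.

End Components.

(** [f] induces a bijection of components without being onto; later it is the inclusion of the black
    vertices among all vertices. *)
Lemma ncomp_surj (T U : finType) (r : rel T) (q : rel U) (f : T -> U) :
    connect_sym r -> connect_sym q ->
    (forall x y, connect r x y = connect q (f x) (f y)) ->
    (forall u, exists x, connect q u (f x)) ->
  ncomp r = ncomp q.
Proof.
move=> sym_r sym_q rq surj.
pose cr x := [set y in [set: T] | connect r x y].
pose cq x := [set y in [set: U] | connect q x y].
have crP x y : connect r x y -> cr x = cr y.
  by move=> xy; apply/setP => z; rewrite !inE; exact: same_connect.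
have cqP x y : connect q x y -> cq x = cq y.
  by move=> xy; apply/setP => z; rewrite !inE; exact: same_connect.
have -> : ncomp q = #|(cq \o f) @: [set: T]|.
  congr #|pred_of_set _|; apply/setP => B; apply/imsetP/imsetP => [[u _ ->]|[x _ ->]].
    by have [x ux] := surj u; exists x => //; apply: cqP.
  by exists (f x).
apply/eqP; rewrite eqn_leq; apply/andP; split; apply: leq_card_imset_ker => x y _ _.
  by move/setP/(_ (f y)); rewrite !inE /= connect0 -rq => /crP.
by move/setP/(_ y); rewrite !inE /= connect0 rq => /cqP.
Qed.

Lemma connect_homo (T U : finType) (r : rel T) (q : rel U) (f : T -> U) :
    {homo f : x y / r x y >-> connect q x y} ->
  {homo f : x y / connect r x y >-> connect q x y}.
Proof.
move=> rq x y /connectP[p]; elim: p x => [x _ ->//|z p IH x /= /andP[xz zp] ey].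
exact: connect_trans (rq _ _ xz) (IH _ zp ey).
Qed.

(** * Riemann-Hurwitz inequality *)

Section Transpositions.

Variable T : finType.
Implicit Types (s u : {perm T}) (x y z : T) (ts : seq (T * T)) (r : rel T).

Lemma connect_porbit r s x y :
  (forall z, connect r z (s z)) -> y \in porbit s x -> connect r x y.
Proof.
move=> rs /porbitP[i ->]; elim: i => [|i IH]; first by rewrite expg0 perm1.
by rewrite expgSr permM; apply: connect_trans IH (rs _).
Qed.

Definition tprod ts : {perm T} := (\prod_(t <- ts) tperm t.1 t.2)%g.

Definition trel ts : rel T := foldr (fun t r => add_edge r t.1 t.2) (fun _ _ => false) ts.

Lemma trel_sym ts : symmetric (trel ts).
Proof. by elim: ts => //= t ts IH; apply: add_edge_sym. Qed.

Lemma trelP ts x y :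
  reflect (exists2 t, t \in ts & (x, y) = t \/ (y, x) = t) (trel ts x y).
Proof.
apply: (iffP idP) => [|[t]].
  elim: ts => //= -[a b] ts IH /or3P[/IH[t tts xy]|/andP[/eqP-> /eqP->]|/andP[/eqP-> /eqP->]].
  - by exists t => //; rewrite inE tts orbT.
  - by exists (a, b); [rewrite inE eqxx|left].
  - by exists (a, b); [rewrite inE eqxx|right].
elim: ts => //= t' ts IH; rewrite inE /add_edge => /orP[/eqP-> [] <-|/IH{}IH /IH->//] /=.
  by rewrite !eqxx orbT.
by rewrite !eqxx !orbT.
Qed.

Lemma connect_tprod ts z : connect (trel ts) z (tprod ts z).
Proof.
rewrite /tprod; elim: ts z => [|[a b] ts IH] z; first by rewrite big_nil perm1.
rewrite big_cons permM /=.
have sub : subrel (connect (trel ts)) (connect (add_edge (trel ts) a b)).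
  by apply: connect_sub => u v uv; apply/connect1/orP; left.
apply: connect_trans (sub _ _ (IH _)).
by case: tpermP => [->|->|//]; apply: connect1; rewrite /add_edge !eqxx ?orbT.
Qed.

(* The inductive form of the Riemann-Hurwitz inequality: prepending a
   transposition either joins two components, and then two cycles as well, or
   leaves the components alone and creates at most one new cycle. *)
Lemma riemann_hurwitz_tprod ts :
  #|T| + #|porbits (tprod ts)| <= size ts + 2 * ncomp (trel ts).
Proof.
elim: ts => [|[a b] ts IH].
  rewrite add0n [trel _]/= ncomp_rel0 mul2n -addnn leq_add2l.
  exact: leq_imset_card.
have comp := ncomp_add_edge a b (trel_sym ts).
have := porbits_mul_tperm (tprod ts) a b.
rewrite /=; have -> : (tperm a b * tprod ts)%g = tprod ((a, b) :: ts) by rewrite /tprod big_cons.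
have : connect (trel ts) a b = false -> a \notin porbit (tprod ts) b.
  move=> nab; apply: contraFN nab; rewrite porbit_sym; apply: connect_porbit.
  exact: connect_tprod.
move: comp IH => /=.
by case: (connect _ a b); case: (a \notin _) => //=; case: (a != b) => /=; lia.
Qed.

Lemma card_porbits_le s : #|porbits s| <= #|T|.
Proof. exact: leq_imset_card. Qed.

Lemma card_porbits1 : #|porbits (1 : {perm T})| = #|T|.
Proof.
rewrite /porbits card_imset // => x y /eqP.
by rewrite eq_porbit_mem => /porbitP[i ->]; rewrite expg1n perm1.
Qed.

(** The Cayley length: the least number of transpositions with product [s]. *)
Definition tlen s := #|T| - #|porbits s|.

Lemma tlen1 : tlen 1%g = 0.
Proof. by rewrite /tlen card_porbits1 subnn. Qed.

Lemma tlenV s : tlen s^-1%g = tlen s.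
Proof. by rewrite /tlen porbitsV. Qed.

Lemma porbitJ s u x : porbit (s ^ u)%g (u x) = u @: porbit s x.
Proof.
apply/setP => y; apply/porbitP/imsetP => [[i ->]|[z /porbitP[i ->] ->]].
  exists ((s ^+ i)%g x); first exact: mem_porbit.
  by rewrite -conjXg conjgE !permM permK.
by exists i; rewrite -conjXg conjgE !permM permK.
Qed.

Lemma tlenJ s u : tlen (s ^ u)%g = tlen s.
Proof.
congr (_ - _); have -> : porbits (s ^ u)%g = [set (imset u (mem B)) | B : {set T} in porbits s].
  apply/setP => B; apply/imsetP/imsetP => [[x _ ->]|[_ /imsetP[x _ ->] ->]].
    exists (porbit s ((u^-1)%g x)); first exact: imset_f.
    by rewrite -porbitJ permKV.
  by exists (u x); rewrite ?porbitJ.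
by rewrite card_imset //; apply: imset_inj; exact: perm_inj.
Qed.

(** A transposition splits a cycle containing both points and otherwise merges two cycles. The
    additive form avoids truncated subtraction. *)
Lemma tlen_mul_tperm s x y : x != y ->
  tlen (tperm x y * s)%g + 2 * (x \in porbit s y) = tlen s + 1.
Proof.
move=> nxy; have := porbits_mul_tperm s x y; rewrite /tlen nxy /=.
have := card_porbits_le s; have := card_porbits_le (tperm x y * s)%g.
by case: (x \in porbit s y) => /=; lia.
Qed.

Lemma porbit_mul_tperm s x y : x != y -> x \notin porbit s y ->
  x \in porbit (tperm x y * s)%g y.
Proof.
move=> nxy nin; have := tlen_mul_tperm s nxy; have := tlen_mul_tperm (tperm x y * s)%g nxy.
by rewrite mulgA tperm2 mul1g (negbTE nin); case: (x \in _) => //; lia.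
Qed.

(** Multiplying by the transposition of [x] and [s x] cuts a cycle, which shortens [s] by one. *)
Lemma tprod_exists s : exists2 ts, tprod ts = s & size ts = tlen s.
Proof.
have [n] := ubnP (tlen s); elim: n s => // n IHn s /ltnSE le_n.
case: (pickP (fun x => s x != x)) => [x sx|s1]; last first.
  have -> : s = 1%g by apply/permP => x; rewrite perm1; apply/eqP/negPn; rewrite s1.
  by exists [::]; rewrite ?tlen1 // /tprod big_nil.
have xsx : x \in porbit s (s x) by rewrite porbit_sym; have := mem_porbit s 1 x; rewrite expg1.
have nx : x != s x by rewrite eq_sym.
have := tlen_mul_tperm s nx; rewrite xsx => len.
have [|ts tsE szE] := IHn (tperm x (s x) * s)%g; first by lia.
exists ((x, s x) :: ts); first by rewrite /tprod big_cons -/(tprod ts) tsE mulgA tperm2 mul1g.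
by rewrite /= szE; lia.
Qed.

(** Each of the [tlen s] transpositions composing [s] involves only two points. *)
Lemma card_moved s : #|[set x | s x != x]| <= 2 * tlen s.
Proof.
have [ts <- <-] := tprod_exists s.
suff sub : [set x | tprod ts x != x] \subset [seq t.1 | t <- ts] ++ [seq t.2 | t <- ts].
  apply: leq_trans (subset_leq_card sub) (leq_trans (card_size _) _).
  by rewrite size_cat !size_map; lia.
apply/subsetP => x; rewrite inE mem_cat; apply: contraR.
rewrite negb_or /tprod; elim: ts => [|t ts IH]; first by rewrite big_nil perm1.
rewrite big_cons permM /= !inE !negb_or -!andbA => /and4P[x1 xts x2 xts2].
by rewrite tpermD ?IH ?xts // eq_sym.
Qed.

End Transpositions.

(** * Distances between colors and the averaged Riemann-Hurwitz bound *)

Section Family.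

Variables (I T : finType).
Implicit Type s : I -> {perm T}.

(* [s k] sends a white vertex to its black neighbour of color [k], so that [step s k l]
   follows an edge of color [k] and then one of color [l], and its orbits are the
   faces of colors [k] and [l]. *)
Definition step s (k l : I) : {perm T} := ((s k)^-1 * s l)%g.

Definition dist s (k l : I) : nat := tlen (step s k l).

Definition steprel s : rel T := fun x y => [exists k, exists l, step s k l x == y].

(** Ordered pairs are summed, so this is twice the sum over k < l, and [tdist s] - 2 D (p - C) is 2
    Delta. *)
Definition tdist s : nat := \sum_k \sum_l dist s k l.

Lemma stepV s k l : (step s k l)^-1%g = step s l k.
Proof. by rewrite /step invMg invgK. Qed.

Lemma distC s k l : dist s k l = dist s l k.
Proof. by rewrite /dist -tlenV stepV. Qed.

Lemma distxx s k : dist s k k = 0.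
Proof. by rewrite /dist /step mulVg tlen1. Qed.

Lemma steprel_step s k l x : steprel s x (step s k l x).
Proof. by apply/existsP; exists k; apply/existsP; exists l. Qed.

Lemma steprel_apply s k l x : steprel s (s k x) (s l x).
Proof. by have := steprel_step s k l (s k x); rewrite permM permK. Qed.

Lemma steprel_sym s : symmetric (steprel s).
Proof.
move=> x y; apply/existsP/existsP => -[k /existsP[l /eqP <-]]; exists l; apply/existsP; exists k;
  by rewrite -stepV permK.
Qed.

Definition fcomp s := ncomp (steprel s).

(** The steps of a closed walk multiply to the identity. Factoring each step into transpositions
    gives a factorization of the identity, to which [riemann_hurwitz_tprod] applies. *)
Lemma cyclic_walk_bound s (c : nat -> I) m :
    c m = c 0 -> (forall k, exists2 j, j <= m & c j = k) ->
  2 * #|T| <= \sum_(j < m) dist s (c j) (c j.+1) + 2 * fcomp s.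
Proof.
move=> c_closed c_surj.
have [ts [tsE szE ts_conn]] : exists ts, [/\ tprod ts = step s (c 0) (c m),
    size ts = \sum_(j < m) dist s (c j) (c j.+1) &
    forall j z, j <= m -> connect (trel ts) (s (c 0) z) (s (c j) z)].
  elim: {c_closed c_surj}m => [|m [ts [tsE szE ts_conn]]].
    exists [::]; split; rewrite /tprod ?big_nil ?big_ord0 /step ?mulVg // => j z.
    by rewrite leqn0 => /eqP ->.
  have [us usE szU] := tprod_exists (step s (c m) (c m.+1)).
  have sub ws : {subset ws <= ts ++ us} -> subrel (connect (trel ws)) (connect (trel (ts ++ us))).
    move=> ws_sub; apply: connect_sub => x y /trelP[t /ws_sub tin tE].
    by apply/connect1/trelP; exists t.
  exists (ts ++ us); split.
  - by rewrite /tprod big_cat /= -/(tprod ts) -/(tprod us) tsE usE /step !mulgA mulgK.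
  - by rewrite size_cat szE szU big_ord_recr.
  have old j z : j <= m -> connect (trel (ts ++ us)) (s (c 0) z) (s (c j) z).
    by move=> /ts_conn jm; apply: sub (jm z) => t tin; rewrite mem_cat tin.
  move=> j z; rewrite leq_eqVlt => /orP[/eqP ->|]; last by rewrite ltnS; exact: old.
  apply: connect_trans (old m z (leqnn m)) (sub us _ _ _ _).
    by move=> t tin; rewrite mem_cat tin orbT.
  by have := connect_tprod us (s (c m) z); rewrite usE permM permK.
have := riemann_hurwitz_tprod ts; rewrite szE tsE c_closed /step mulVg card_porbits1 addnn -mul2n.
(* As the walk visits every color, its transpositions connect [s k z] with [s l z] for all [k] and
   [l]. *)
move=> /leq_trans; apply; rewrite leq_add2l leq_pmul2l //.
have sym_ts := sym_connect_sym (trel_sym ts).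
apply: (ncomp_sub (sym_connect_sym (steprel_sym s)) sym_ts) => x y.
case/existsP => k /existsP[l /eqP <-]; pose z := ((s k)^-1 x)%g.
have [[jk lek ck] [jl lel cl]] := (c_surj k, c_surj l).
rewrite /step permM -/z -[x in connect _ x](permKV (s k)) -/z -ck -cl.
by apply: connect_trans (ts_conn _ z lel); rewrite sym_ts ts_conn.
Qed.

End Family.

(** The symmetric group is 2-transitive: reindex by an [h] sending [x], [y] to [x'], [y']. *)
Lemma sum_perm_pair (I : finType) (F : I -> I -> nat) (x y x' y' : I) :
  x != y -> x' != y' ->
  \sum_(g : {perm I}) F (g x) (g y) = \sum_(g : {perm I}) F (g x') (g y').
Proof.
move=> nxy nxy'; pose h := (tperm x x' * tperm (tperm x x' y) y')%g.
have hx : h x = x'.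
  rewrite permM tpermL tpermD //; last by rewrite eq_sym.
  by apply: contra nxy => /eqP; rewrite -[X in _ = X](tpermL x x') => /perm_inj ->.
have hy : h y = y' by rewrite permM tpermL.
rewrite [RHS](reindex_inj (mulgI h^-1%g)) /=; apply: eq_bigr => g _.
by rewrite !permM -hx -hy !permK.
Qed.

Lemma sum_perm_dist (I T : finType) (s : I -> {perm T}) (x y : I) : x != y ->
  (#|I| * #|I|.-1) * \sum_(g : {perm I}) dist s (g x) (g y) = #|{: {perm I}}| * tdist s.
Proof.
move=> nxy; pose E := \sum_(g : {perm I}) dist s (g x) (g y).
have off k (F : I -> nat) : F k = 0 -> \sum_(l | l != k) F l = \sum_l F l.
  by move=> Fk; rewrite [RHS](bigD1 k) //= Fk.
have -> : #|I| * #|I|.-1 * E = \sum_(k : I) \sum_(l | l != k) E.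
  rewrite -mulnA -sum_nat_const; apply: eq_bigr => k _.
  by rewrite sum_nat_const; congr (_ * _); rewrite -(cardC1 k).
transitivity (\sum_(k : I) \sum_(l | l != k) \sum_(g : {perm I}) dist s (g k) (g l)).
  apply: eq_bigr => k _; apply: eq_bigr => l nlk.
  by apply: sum_perm_pair; rewrite // eq_sym.
transitivity (\sum_(g : {perm I}) \sum_k \sum_l dist s (g k) (g l)).
  rewrite [RHS]exchange_big /=; apply: eq_bigr => k _.
  by rewrite [RHS]exchange_big /=; apply: off; apply: big1 => g _; rewrite distxx.
rewrite -sum_nat_const; apply: eq_bigr => g _.
rewrite /tdist [RHS](reindex_inj (@perm_inj _ g)) /=; apply: eq_bigr => k _.
by rewrite [RHS](reindex_inj (@perm_inj _ g)).
Qed.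

(* Averaging [cyclic_walk_bound] over all cyclic orders of the colors: this is
   the expression of the degree as a sum of genera of jackets. *)
Lemma tdist_bound (n : nat) (T : finType) (s : 'I_n.+1 -> {perm T}) :
  2 * n * #|T| <= tdist s + 2 * n * fcomp s.
Proof.
case: n s => [|n] s; first by rewrite muln0 mul0n.
pose c (j : nat) : 'I_n.+2 := inord (j %% n.+2).
have walk (g : {perm 'I_n.+2}) :
    2 * #|T| <= \sum_(j < n.+2) dist s (g (c j)) (g (c j.+1)) + 2 * fcomp s.
  apply: (@cyclic_walk_bound _ _ s (g \o c)); first by rewrite /c /= modnn mod0n.
  move=> k; exists ((g^-1)%g k); first exact: ltnW.
  by rewrite /= /c modn_small ?inord_val ?permKV.
have nc (j : nat) : c j != c j.+1.
  apply/eqP => /(congr1 (@nat_of_ord _)); rewrite /c !inordK ?ltn_pmod // => /eqP.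
  by rewrite -[j.+1]addn1 -{1}[j]addn0 eqn_modDl mod0n modn_small.
have : \sum_(g : {perm 'I_n.+2}) 2 * #|T| <=
    \sum_(g : {perm 'I_n.+2}) (\sum_(j < n.+2) dist s (g (c j)) (g (c j.+1)) + 2 * fcomp s).
  by apply: leq_sum => g _; exact: walk.
rewrite sum_nat_const big_split sum_nat_const exchange_big /=.
set N := (X in X * (2 * _) <= _); have N_gt0 : 0 < N by apply/card_gt0P; exists 1%g.
rewrite -(leq_pmul2l (ltn0Sn n)) => le.
rewrite -(leq_pmul2l N_gt0) mulnDr -[N * tdist s]mulnC.
have E (j : 'I_n.+2) : n.+2 * n.+1 * \sum_(g : {perm 'I_n.+2}) dist s (g (c j)) (g (c j.+1)) = N * tdist s.
  by have := sum_perm_dist s (nc j); rewrite card_ord.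
have : n.+2 * (n.+1 * \sum_(j < n.+2) \sum_(g : {perm 'I_n.+2}) dist s (g (c j)) (g (c j.+1))) = n.+2 * (N * tdist s).
  rewrite mulnA big_distrr /= (eq_bigr (fun=> N * tdist s)) => [|j _]; last exact: E.
  by rewrite sum_nat_const card_ord.
move=> /eqP; rewrite eqn_pmul2l // => /eqP Es.
by move: le; rewrite mulnDr Es; nia.
Qed.

(** * Switching edges *)

Section Switching.

Variables (I T : finType).
Implicit Types (s : I -> {perm T}) (K : {set I}).

Lemma fcomp_sub (J : finType) s (q : J -> {perm T}) :
  subrel (steprel q) (steprel s) -> fcomp s <= fcomp q.
Proof.
move=> sub; apply: (ncomp_sub (sym_connect_sym (steprel_sym q)) (sym_connect_sym (steprel_sym s))).
by move=> x y /sub; exact: connect1.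
Qed.

Lemma tlen_mulC (u v : {perm T}) : tlen (u * v)%g = tlen (v * u)%g.
Proof. by rewrite -(tlenJ (v * u)%g v) conjgE mulgA mulKg. Qed.

(** The transposition acts after [s k], hence on black ends of edges. A set of colors is allowed in
    view of the 3 + 3 pattern. *)
Definition switch s (K : {set I}) (x y : T) : I -> {perm T} :=
  fun k => if k \in K then (s k * tperm x y)%g else s k.

(** An additional edge between [x] and [y] restores all old connections. The form of the hypothesis
    also covers families with a color omitted. *)
Lemma fcomp_switch (s s' : I -> {perm T}) x y :
    (forall k, s' k = s k \/ s' k = (s k * tperm x y)%g) ->
  fcomp s' <= fcomp s + ~~ connect (steprel s') x y.
Proof.
move=> s's; apply: leq_trans (ncomp_add_edge x y (steprel_sym s')) _; rewrite leq_add2r.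
have sym2 := sym_connect_sym (add_edge_sym x y (steprel_sym s')).
have swap1 k z : connect (add_edge (steprel s') x y) (s k z) (s' k z).
  case: (s's k) => ->; first exact: connect0.
  by rewrite permM; case: tpermP => [->|->|_ _]; rewrite ?connect0 //;
    apply: connect1; rewrite /add_edge !eqxx ?orbT.
apply: (ncomp_sub (sym_connect_sym (steprel_sym s)) sym2) => a b.
case/existsP => k /existsP[l /eqP <-]; rewrite /step permM.
rewrite -[a in connect _ a](permKV (s k)); set z := (_ a).
apply: connect_trans (swap1 k z) _; rewrite sym2; apply: connect_trans (swap1 l z) _.
by apply: connect1; rewrite /add_edge steprel_apply.
Qed.

Lemma dist_switch_mixed s K x y k l : x != y -> k \notin K -> l \in K ->
  dist (switch s K x y) k l + 2 * (x \in porbit (step s k l) y) = dist s k l + 1.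
Proof.
move=> nxy kK lK; rewrite /dist /step /switch (negbTE kK) lK mulgA tlen_mulC.
exact: tlen_mul_tperm.
Qed.

Lemma dist_switch_same s K x y k l : (k \in K) = (l \in K) ->
  dist (switch s K x y) k l = dist s k l.
Proof.
move=> kl; rewrite /dist /step /switch kl; case: (l \in K) => //.
by rewrite invMg mulgA tlen_mulC !mulgA mulgV mul1g.
Qed.

Lemma tdist_split s (K : {set I}) :
  tdist s = 2 * (\sum_(k | k \notin K) \sum_(l in K) dist s k l) +
    (\sum_(k in K) \sum_(l in K) dist s k l
     + \sum_(k | k \notin K) \sum_(l | l \notin K) dist s k l).
Proof.
rewrite /tdist (bigID (mem K)) /=.
have E k : \sum_l dist s k l = \sum_(l in K) dist s k l + \sum_(l | l \notin K) dist s k l.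
  by rewrite (bigID (mem K)).
rewrite !(eq_bigr _ (fun k _ => E k)) !big_split /= [X in _ + X + _]exchange_big /=.
rewrite [X in _ + X + _](eq_bigr (fun k => \sum_(l in K) dist s k l)) => [|k _]; first by lia.
by apply: eq_bigr => l _; rewrite distC.
Qed.

(** Only distances between a color in [K] and one outside change: by -1 if [x] and [y] share a face
    of these colors, by +1 otherwise. Both orders of each pair are counted. *)
Lemma tdist_switch s K x y : x != y ->
  tdist (switch s K x y)
    + 4 * (\sum_(k | k \notin K) \sum_(l in K) (x \in porbit (step s k l) y)) =
  tdist s + 2 * (#|~: K| * #|K|).
Proof.
move=> nxy; rewrite !(tdist_split _ K).
have -> : \sum_(k in K) \sum_(l in K) dist (switch s K x y) k l = \sum_(k in K) \sum_(l in K) dist s k l.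
  by apply: eq_bigr => k kK; apply: eq_bigr => l lK; rewrite dist_switch_same ?kK.
have -> : \sum_(k | k \notin K) \sum_(l | l \notin K) dist (switch s K x y) k l =
    \sum_(k | k \notin K) \sum_(l | l \notin K) dist s k l.
  by apply: eq_bigr => k /negbTE kK; apply: eq_bigr => l /negbTE lK; rewrite dist_switch_same ?kK ?lK.
have : \sum_(k | k \notin K) \sum_(l in K) dist (switch s K x y) k l +
    2 * (\sum_(k | k \notin K) \sum_(l in K) (x \in porbit (step s k l) y)) =
    \sum_(k | k \notin K) \sum_(l in K) dist s k l + #|~: K| * #|K|.
  rewrite -sum_nat_const big_distrr /= -big_split /=.
  rewrite [X in _ + X](eq_bigl (fun k => k \notin K)) => [|k]; last by rewrite inE.
  rewrite -big_split /=; apply: eq_bigr => k kK.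
  rewrite -sum1_card big_distrr /= -!big_split /=; apply: eq_bigr => l lK.
  exact: dist_switch_mixed.
lia.
Qed.

(** The edges of colors [k] and [l] at the white vertex [z] lie on one face; this makes switching
    their ends lower a distance. *)
Lemma mem_porbit_step s k l z : s k z \in porbit (step s k l) (s l z).
Proof.
rewrite porbit_sym; have := mem_porbit (step s k l) 1 (s k z).
by rewrite expg1 /step permM permK.
Qed.

(** The switch merges the two faces through [x] and [y] into one, which connects them. *)
Lemma connect_switch1 s i k x y : x != y -> k != i ->
    x \notin porbit (step s k i) y ->
  connect (steprel (switch s [set i] x y)) x y.
Proof.
move=> nxy ki nin; have sym := sym_connect_sym (steprel_sym (switch s [set i] x y)).
have E : step (switch s [set i] x y) k i = ((tperm x y * step s k i) ^ tperm x y)%g.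
  by rewrite /step /switch !inE eqxx (negbTE ki) conjgE !mulgA mulVg mul1g.
apply: (@connect_porbit _ _ (step (switch s [set i] x y) k i)) => [z|].
  exact/connect1/steprel_step.
rewrite E -[X in porbit _ X](tpermR x y) porbitJ; apply/imsetP; exists x; rewrite ?tpermL //.
exact: porbit_mul_tperm.
Qed.

End Switching.

(** * Counting parallel edges *)

Lemma sum_sym_pairs n (f : 'I_n -> 'I_n -> nat) :
    (forall k, f k k = 0) -> (forall k l, f k l = f l k) ->
  \sum_k \sum_l f k l = 2 * \sum_(k < n) \sum_(l < n | l < k) f k l.
Proof.
move=> f0 fC.
have E k : \sum_l f k l = \sum_(l < n | l < k) f k l + \sum_(l < n | k < l) f k l.
  rewrite (bigID (fun l : 'I_n => l < k)) /=; congr (_ + _).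
  rewrite (bigID (fun l : 'I_n => l == k)) /= [X in X + _]big1 ?add0n => [|l /andP[_ /eqP->]//].
  by apply: eq_bigl => l; rewrite -leqNgt ltn_neqAle andbC eq_sym.
rewrite (eq_bigr _ (fun k _ => E k)) big_split /= mul2n -addnn; congr (_ + _).
rewrite (exchange_big_dep xpredT) //=; apply: eq_bigr => k _.
by apply: eq_bigr => l _; rewrite fC.
Qed.

Definition npairs n (U : eqType) (c : 'I_n -> U) : nat := \sum_k \sum_l (c k != c l).

(* The bound excludes all multiplicities smaller than those of [(D - 1) + 1 + 1], with
   the only exception of [3 + 3] for [D = 5], which ties with [4 + 1 + 1]. *)
Lemma npairs_pattern D (U : finType) (c : 'I_D.+1 -> U) :
    3 <= D -> npairs c < 4 * D ->
  (exists a, D.-1 <= #|[set k | c k == a]|) \/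
  (D = 5 /\ exists a b, [/\ a != b, #|[set k | c k == a]| = 3 & #|[set k | c k == b]| = 3]).
Proof.
move=> hD small; pose fib a := [set k | c k == a].
have [k0 _ maxk] := arg_maxnP (fun k => #|fib (c k)|) (isT : xpredT (ord0 : 'I_D.+1)).
pose A := fib (c k0); pose m := #|A|; pose b := #|~: A|.
have mb : m + b = D.+1 by rewrite /m /b cardsC card_ord.
have m_gt0 : 0 < m by apply/card_gt0P; exists k0; rewrite inE.
case: (leqP D.-1 m) => [mD|mD]; first by left; exists (c k0).
have row k : \sum_l (c k != c l : nat) = #|~: fib (c k)|.
  rewrite -sum1_card [RHS]big_mkcond /=; apply: eq_bigr => l _.
  by rewrite !inE eq_sym; case: (_ == _).
have row_split k : #|fib (c k)| + #|~: fib (c k)| = D.+1 by rewrite cardsC card_ord.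
have rowA k : k \in A -> #|~: fib (c k)| = b by rewrite inE => /eqP ->.
have row_ge k : b <= #|~: fib (c k)|.
  have le : #|fib (c k)| <= m := maxk k isT.
  by have := row_split k; lia.
have row_geA k : k \notin A -> m <= #|~: fib (c k)|.
  move=> kA; apply: subset_leq_card; apply/subsetP => l; rewrite !inE in kA *.
  by move=> /eqP ->; rewrite eq_sym.
have M_split : npairs c = m * b + \sum_(k in ~: A) #|~: fib (c k)|.
  rewrite /npairs (eq_bigr _ (fun k _ => row k)) (bigID (mem A)) /=; congr (_ + _).
    by rewrite (eq_bigr _ rowA) sum_nat_const.
  by apply: eq_bigl => k; rewrite in_setC.
(* Parity is needed for [m = 2] and [D = 4], where the other bounds leave the value 15. *)
have M_even : ~~ odd (npairs c).
  rewrite /npairs (@sum_sym_pairs _ (fun k l => c k != c l)); first by rewrite oddM.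
    by move=> k; rewrite eqxx.
  by move=> k l; rewrite eq_sym.
have M_m : m * b + b * m <= npairs c.
  rewrite M_split leq_add2l -[X in X <= _]sum_nat_const; apply: leq_sum => k.
  by rewrite inE; exact: row_geA.
have M_b : m * b + b * b <= npairs c.
  rewrite M_split leq_add2l -[X in X <= _]sum_nat_const; apply: leq_sum => k _.
  exact: row_ge.
have [m1|m2|m_big] : [\/ m = 1, m = 2 | 3 <= m].
- by case: (m) m_gt0 => [|[|[|?]]] // _; [constructor 1|constructor 2|constructor 3].
- by exfalso; nia.
- exfalso; have bE : b = D.-1 by lia.
  move: M_b small M_even; rewrite m2 bE; move: (npairs c) => N le_N lt_N.
  have D4 : D = 4 by nia.
  by move: le_N lt_N; rewrite D4 => /=; lia.
(* From 2 m b < 4 D = 4 (m + b - 1) follows (m - 2) (b - 2) < 2, with both factors positive. *)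
have [m3 b3] : m = 3 /\ b = 3 by nia.
have D5 : D = 5 by lia.
right; split=> //; exists (c k0).
have M18 : npairs c = 18.
  by move: M_m small M_even; move: (npairs c) => N; rewrite m3 b3 D5; lia.
have /card_gt0P[k1 k1A] : 0 < #|~: A| by rewrite -/b b3.
exists (c k1); split; [by move: k1A; rewrite !inE eq_sym|by []|].
(* The three rows outside [A] sum to 9 and each is at least 3, so the row of [k1] is exactly 3. *)
have := M_split; rewrite M18 m3 b3 (bigD1 k1) //= => /eqP.
have : \sum_(k in ~: A | k != k1) 3 <= \sum_(k in ~: A | k != k1) #|~: fib (c k)|.
  by apply: leq_sum => k _; rewrite -b3.
have : \sum_(k in ~: A) 3 = 9 by rewrite sum_nat_const -/b b3.
rewrite (bigD1 k1) //= => s9 ge9 /eqP e9; have := row_ge k1; have := row_split k1.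
rewrite b3 -/(fib (c k1)); move: s9 ge9 e9 D5.
move: (\sum_(i in ~: A | i != k1) 3) (\sum_(i in ~: A | i != k1) #|~: fib (c i)|).
by move: #|fib (c k1)| #|~: fib (c k1)|; lia.
Qed.

Section Counting.

Variables (n : nat) (T : finType) (s : 'I_n.+1 -> {perm T}).

Definition trivial_at z := [forall k, s k z == s ord0 z].

(** Each trivial white vertex accounts for a component of its own, and the component at [z0] is yet
    another one. *)
Lemma fcomp_trivial (z0 : T) : ~~ trivial_at z0 ->
  #|T| + 1 <= #|[set z | ~~ trivial_at z]| + fcomp s.
Proof.
move=> nt0; pose P := [set z | trivial_at z].
have -> : #|T| = #|P| + #|[set z | ~~ trivial_at z]|.
  by rewrite -(cardsC P); congr (_ + #|pred_of_set _|); apply/setP => z; rewrite !inE.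
suff: #|P| + 1 <= fcomp s by lia.
pose cl x := [set y in [set: T] | connect (steprel s) x y].
have clP z : z \in P -> cl (s ord0 z) = [set s ord0 z].
  rewrite inE => /forallP tz; apply/setP => y; rewrite !inE /=; apply/idP/eqP => [|->]; last exact: connect0.
  case/connectP => p; elim: p y => [//|x p IH] y /= /andP[/existsP[k /existsP[l /eqP xE]] px ey].
  have xz : x = s ord0 z by rewrite -xE /step permM -{1}(eqP (tz k)) permK (eqP (tz l)).
  by rewrite xz in px ey; exact: IH px ey.
have sub : cl (s ord0 z0) |: [set cl (s ord0 z) | z in P] \subset
    equivalence_partition (connect (steprel s)) [set: T].
  by apply/subsetP => B; rewrite in_setU1 => /orP[/eqP->|/imsetP[w _ ->]]; apply: imset_f.
have le_cl : _ <= fcomp s := subset_leq_card sub; apply: (leq_trans _ le_cl).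
rewrite cardsU1 addnC.
rewrite card_in_imset => [|y z /clP-> /clP-> /set1_inj /perm_inj //].
suff -> : cl (s ord0 z0) \notin [set cl (s ord0 z) | z in P] by [].
apply/imsetP => -[w Pw]; rewrite (clP w Pw) => /setP/(_ (s ord0 z0)).
rewrite !inE connect0 => /esym/eqP/perm_inj E; move: Pw nt0.
by rewrite inE -E => ->.
Qed.

(** For fixed [k] and [l], the vertices with non-parallel edges correspond to the points moved by
    [step s k l]. *)
Lemma sum_npairs : \sum_z npairs (fun k => s k z) <= 2 * tdist s.
Proof.
rewrite /npairs /tdist exchange_big /= big_distrr /=; apply: leq_sum => k _.
rewrite exchange_big /= big_distrr /=; apply: leq_sum => l _.
apply: leq_trans (card_moved _).
rewrite -sum1_card [X in _ <= X]big_mkcond /= [X in _ <= X](reindex_inj (@perm_inj _ (s k))) /=.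
apply: leq_sum => z _; rewrite inE /step permM permK eq_sym.
by case: (_ == _).
Qed.

(** There are at least p - C + 1 nontrivial vertices; with 4 D pairs at each, [sum_npairs] would
    give [tdist s] at least 2 D (p - C + 1). *)
Lemma few_pairs_exists (D := n) (z0 : T) : ~~ trivial_at z0 ->
    tdist s + 2 * D * fcomp s < 2 * D * #|T| + 2 * D ->
  exists2 z, ~~ trivial_at z & npairs (fun k => s k z) < 4 * D.
Proof.
move=> nt0 small; apply/exists_inP; apply: contraT; rewrite negb_exists_in => /forall_inP big.
have le1 := fcomp_trivial nt0; have le2 := sum_npairs.
have : \sum_(z in [set z | ~~ trivial_at z]) 4 * D <= \sum_z npairs (fun k => s k z).
  rewrite [X in _ <= X](bigID (mem [set z | ~~ trivial_at z])) /=.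
  apply: leq_trans (leq_addr _ _); apply: leq_sum => z; rewrite inE => /big.
  by rewrite -leqNgt.
rewrite sum_nat_const; move: le1 le2 small; rewrite -/D.
by move: #|_| #|_| (fcomp s) (tdist s) (\sum_z _); nia.
Qed.

End Counting.

(** * The gap *)

Section Gap.

Variables (D : nat) (T : finType).
Implicit Type s : 'I_D.+1 -> {perm T}.

Lemma switch_cases s (K : {set 'I_D.+1}) x y k : switch s K x y k = s k \/ switch s K x y k = (s k * tperm x y)%g.
Proof. by rewrite /switch; case: ifP; [right|left]. Qed.

Lemma tdist_const s : (forall z, trivial_at s z) -> tdist s = 0.
Proof.
move=> triv; have E k : s k = s ord0 by apply/permP => z; exact/eqP/(forallP (triv z)).
by rewrite /tdist big1 // => k _; rewrite big1 // => l _; rewrite /dist /step !E mulVg tlen1.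
Qed.

(* The colors [k] with [s k z = a] form a bundle of parallel edges at [z], which the
   switch extends by the color [i]. *)
Lemma switch_one s i a z (y := s i z) (s' := switch s [set i] a y)
    (r := #|[set k | (k != i) && (a \in porbit (step s k i) y)]|) : y != a ->
  [/\ tdist s' + 4 * r = tdist s + 2 * D,
      #|[set k | s k z == a]| <= r <= D,
      fcomp s' <= fcomp s + 1,
      r < D -> exists2 k, k != i & a \notin porbit (step s k i) y
    & forall k, k != i -> a \notin porbit (step s k i) y ->
        s k z != a /\ connect (steprel s') a y].
Proof.
move=> nya; have nay : a != y by rewrite eq_sym.
have rD : r <= D.
  have -> : D = #|[set~ i]| by rewrite cardsC1 card_ord.
  by apply: subset_leq_card; apply/subsetP => k; rewrite !inE => /andP[].
split.
- have := tdist_switch s [set i] nay; rewrite cards1 muln1 cardsC1 card_ord => <-.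
  congr (_ + 4 * _); rewrite /r -sum1_card [LHS]big_mkcond [RHS]big_mkcond /=; apply: eq_bigr => k _.
  by rewrite !inE big_set1; case: (k != i) => //=; case: (a \in _).
- rewrite rD andbT; apply: subset_leq_card; apply/subsetP => k; rewrite !inE => /eqP ka.
  rewrite -ka mem_porbit_step andbT; apply: contra nya => /eqP ki.
  by rewrite -ka ki.
- by apply: leq_trans (fcomp_switch (switch_cases s [set i] a y)) _; rewrite leq_add2l leq_b1.
- move=> ltr; have : exists k, (k != i) && (a \notin porbit (step s k i) y).
    apply/existsP; apply: contraLR ltr; rewrite negb_exists -leqNgt => /forallP all.
    have {1}-> : D = #|[set~ i]| by rewrite cardsC1 card_ord.
    apply: subset_leq_card; apply/subsetP => k; rewrite !inE => ki.
    by have := all k; rewrite ki /= negbK.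
  by case=> k /andP[]; exists k.
move=> k ki nin; split; last exact: connect_switch1 nay ki nin.
by apply: contra nin => /eqP <-; exact: mem_porbit_step.
Qed.

(* Switching a whole bundle of three at once leaves the distances inside it unchanged
   and lowers the other nine by one. *)
Lemma switch_three s a b z : D = 5 -> a != b ->
    #|[set k | s k z == a]| = 3 -> #|[set k | s k z == b]| = 3 ->
  exists s' : 'I_D.+1 -> {perm T}, tdist s' + 18 = tdist s /\ fcomp s' <= fcomp s + 1.
Proof.
move=> D5 nab cA cB; pose K := [set k | s k z == b].
exists (switch s K a b); split; last first.
  by apply: leq_trans (fcomp_switch (switch_cases s K a b)) _; rewrite leq_add2l leq_b1.
have cC : #|~: K| = 3 by have := cardsC K; rewrite card_ord cB; move: D5; lia.
have KC : ~: K = [set k | s k z == a].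
  apply/esym/eqP; rewrite eqEcard cA cC leqnn andbT; apply/subsetP => k; rewrite !inE.
  by move=> /eqP ->.
have := tdist_switch s K nab; rewrite cC cB.
suff -> : \sum_(k | k \notin K) \sum_(l in K) (a \in porbit (step s k l) b) = 9 by lia.
rewrite (eq_bigr (fun=> 3)) => [|k kK].
  rewrite sum_nat_const; transitivity (#|~: K| * 3); last by rewrite cC.
  by congr (_ * _); apply: eq_card => k; rewrite in_setC.
rewrite (eq_bigr (fun=> 1)) => [|l lK]; first by rewrite sum1_card.
have /eqP <- : s k z == a by have := kK; rewrite -in_setC KC inE.
have /eqP <- : s l z == b by have := lK; rewrite inE.
by rewrite mem_porbit_step.
Qed.

Lemma exists_pattern s : 3 <= D -> ~ (forall z, trivial_at s z) ->
    tdist s + 2 * D * fcomp s < 2 * D * #|T| + 2 * D ->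
  (exists z a i, s i z != a /\ D.-1 <= #|[set k | s k z == a]|) \/
  (D = 5 /\ exists s' : 'I_D.+1 -> {perm T}, tdist s' + 18 = tdist s /\ fcomp s' <= fcomp s + 1).
Proof.
move=> hD ntriv small.
have [z0 nt0] : exists z, ~~ trivial_at s z.
  by apply/existsP; apply: contra_notT ntriv; rewrite negb_exists => /forallP H z; apply/negPn.
have [z ntz few] := few_pairs_exists nt0 small.
have [[a am]|[D5 [a [b [nab ca cb]]]]] := npairs_pattern hD few.
  left; exists z, a; move: ntz; rewrite negb_forall => /existsP[k kz].
  (* The edges of colors [k] and [ord0] at [z] have different ends, so one of them avoids [a]. *)
  have [ka|] := eqVneq (s k z) a; last by exists k.
  by exists ord0; split=> //; rewrite -ka eq_sym.
by right; split=> //; exact: switch_three D5 nab ca cb.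
Qed.

Lemma degree_gap s : 3 <= D ->
    tdist s + 2 * D * fcomp s < 2 * D * #|T| + 2 * (D - 2) ->
  tdist s + 2 * D * fcomp s = 2 * D * #|T|.
Proof.
move=> hD; have [m] := ubnP (tdist s); elim: m s => // m IH s /ltnSE le_m small.
suff: tdist s + 2 * D * fcomp s <= 2 * D * #|T| by have := tdist_bound s; lia.
have := boolP [forall z, trivial_at s z]; case=> [/forallP triv|ntriv].
  by rewrite (tdist_const triv) add0n leq_mul2l (ncomp_le (steprel s)) orbT.
have ntriv' : ~ (forall z, trivial_at s z) by move=> triv; case/negP: ntriv; apply/forallP.
have small' : tdist s + 2 * D * fcomp s < 2 * D * #|T| + 2 * D by lia.
have [[z [a [i [nia am]]]]|[D5 [s' [ts' fs']]]] := exists_pattern hD ntriv' small'; last first.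
  (* In the 3 + 3 case 2 Delta is below 6 and changes by at most -18 + 10, hence becomes
     negative. *)
  have := tdist_bound s'; move: small ts' fs'; have : D - 2 = 3 by rewrite D5.
  by move=> ->; have -> : 2 * D = 10 by [rewrite D5]; nia.
have [tE /andP[rge rle] fle rlt rconn] := switch_one nia.
set s' := switch _ _ _ _ in tE fle rlt rconn.
set r := #|_| in tE rge rle rlt.
have bound := tdist_bound s'.
move: rle; rewrite leq_eqVlt => /orP[/eqP rD|/rlt[k ki /(rconn _ ki)[_ conn]]].
  (* Here [tdist] drops by 2 D; without a new component 2 Delta would become negative. *)
  have fE : fcomp s' = fcomp s + 1 by nia.
  have : tdist s' + 2 * D * fcomp s' = 2 * D * #|T| by apply: IH; nia.
  by nia.
(* Now r = D - 1, and 2 Delta drops by at least 2 (D - 2) without a new component, against its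
   bound. *)
have := fcomp_switch (switch_cases s [set i] a (s i z)); rewrite -/s' conn addn0 => fle'.
by nia.
Qed.

End Gap.

(** * Omitting a color, and the extremal core graphs *)

Section Lift.

Variables (D : nat) (T : finType).
Implicit Type s : 'I_D.+1 -> {perm T}.

Definition omit s k : 'I_D -> {perm T} := fun j => s (@lift D.+1 k j).

Lemma steprel_omit s k : subrel (steprel (omit s k)) (steprel s).
Proof. by move=> x y /existsP[i /existsP[j /eqP <-]]; exact: steprel_step. Qed.

Lemma fcomp_omit s k : fcomp s <= fcomp (omit s k).
Proof. by apply: fcomp_sub; exact: steprel_omit. Qed.

Lemma tdist_omit s k : tdist s = tdist (omit s k) + 2 * \sum_l dist s k l.
Proof.
rewrite /tdist (bigD1_ord k) //= (eq_bigr (fun i => dist s k (lift k i) + \sum_j dist (omit s k) i j)).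
  by rewrite big_split /= [X in 2 * X](bigD1_ord k) //= distxx [X in X + _](bigD1_ord k) //= distxx; lia.
by move=> i _; rewrite (bigD1_ord k) //= distC.
Qed.

(** A distance between two distinct colors is lost in exactly two of the D + 1 omissions. *)
Lemma sum_tdist_omit s : \sum_k tdist (omit s k) + 2 * tdist s = D.+1 * tdist s.
Proof.
rewrite {2}/tdist big_distrr -big_split /= (eq_bigr (fun=> tdist s)) => [|k _]; last by rewrite -tdist_omit.
by rewrite sum_nat_const card_ord.
Qed.

End Lift.

Lemma omit_bound D (T : finType) (s : 'I_D.+1 -> {perm T}) k : 0 < D ->
  2 * D.-1 * #|T| <= tdist (omit s k) + 2 * D.-1 * fcomp (omit s k).
Proof. by case: D s k => // n s k _; exact: tdist_bound. Qed.

(* After the switch of color [i], omitting a color [k] other than [j] leaves a connected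
   graph, because [i] and [j] together connect the two ends that were exchanged; and
   omitting [j] leaves at most two components. *)
Lemma core_gap D (T : finType) (s : 'I_D.+1 -> {perm T}) : 3 <= D ->
    fcomp s = 1 -> (forall k, fcomp (omit s k) = 1) ->
    tdist s + 2 * D = 2 * D * #|T| + 2 * (D - 2) ->
  #|T| = 2 /\ exists z a i j,
    [/\ i != j, s i z != a, s j z != a & forall k, k != i -> k != j -> s k z = a].
Proof.
move=> hD conn conn_omit deg.
have x0 : 0 < #|T| by have := ncomp_le (steprel s); rewrite -/(fcomp s) conn.
have [ntriv small] : ~ (forall z, trivial_at s z) /\
    tdist s + 2 * D * fcomp s < 2 * D * #|T| + 2 * D.
  split; last by rewrite conn; lia.
  by move=> /tdist_const t0; move: deg; rewrite t0; nia.
have [[z [a [i [nia am]]]]|[D5 [s' [ts' fs']]]] := exists_pattern hD ntriv small; last first.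
  have := tdist_bound s'; move: deg ts' fs'; have : D - 2 = 3 by rewrite D5.
  by move=> ->; have -> : 2 * D = 10 by [rewrite D5]; rewrite conn; nia.
have [tE /andP[rge rle] _ rlt rconn] := switch_one nia.
set s' := switch _ _ _ _ in tE rlt rconn.
set r := #|_| in tE rge rle rlt.
(* Omitting [i] discards the only color that was switched. *)
have omit_i : fcomp (omit s' i) <= 1.
  rewrite -(conn_omit i); apply: fcomp_sub => x y /existsP[k /existsP[l /eqP <-]].
  have E m : omit s' i m = omit s i m.
    by rewrite /omit /s' /switch inE eq_sym (negbTE (neq_lift _ _)).
  by have := steprel_step (omit s' i) k l x; rewrite /step !E.
have bound := tdist_bound s'.
have fs' : fcomp s' <= 1 := leq_trans (fcomp_omit s' i) omit_i.
(* For r = D the new value of 2 Delta would be at most -4, as no component is gained. *)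
have rltD : r < D by nia.
have [j ji nj] := rlt rltD; have [nja _] := rconn j ji nj.
have others k : k != i -> k != j -> s k z = a.
  move=> ki kj; apply/eqP; apply: contraLR am => nka; rewrite -ltnNge.
  have sub : [set l | s l z == a] \subset ~: [set i; j; k].
    apply/subsetP => l; rewrite !inE !negb_or => /eqP la.
    by apply/andP; split; [apply/andP; split|]; apply/eqP => E; move: nia nja nka; rewrite -?E la eqxx.
  have c3 : #|[set i; j; k]| = 3.
    by rewrite setUC cardsU1 cards2 !inE negb_or ki kj eq_sym ji.
  have := subset_leq_card sub; have := cardsC [set i; j; k]; rewrite c3 card_ord; lia.
split; last by exists z, a, i, j; split=> //; rewrite eq_sym.
have T2 : 1 < #|T| by apply/card_gt1P; exists (s i z), a.
suff: #|T| <= 2 by lia.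
have omit_k k : fcomp (omit s' k) <= 1 + (k == j).
  have [->|ki] := eqVneq k i; first by apply: leq_trans omit_i _; rewrite leq_addr.
  have := @fcomp_switch _ _ (omit s k) (omit s' k) a (s i z)
    (fun l => switch_cases s [set i] a (s i z) (lift k l)).
  rewrite conn_omit; move=> /leq_trans; apply; rewrite leq_add2l.
  have [->|kj] := eqVneq k j; first exact: leq_b1.
  suff -> : connect (steprel (omit s' k)) a (s i z) by [].
  have [i' iE _] := unlift_some ki; have [j' jE _] := unlift_some kj.
  have nj' : a \notin porbit (step (omit s k) j' i') (s i z) by move: nj; rewrite jE iE.
  have ji' : j' != i' by move: ji; rewrite jE iE (inj_eq (@lift_inj _ k)).
  have nai : a != s i z by rewrite eq_sym.
  apply: connect_sub (connect_switch1 nai ji' nj') => x y /existsP[l /existsP[m /eqP <-]].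
  have E h : switch (omit s k) [set i'] a (s i z) h = omit s' k h.
    by rewrite /switch /omit /s' /switch !inE iE (inj_eq (@lift_inj _ k)).
  by rewrite /step !E; apply/connect1/steprel_step.
(* The Riemann-Hurwitz bounds of the D + 1 omissions are added. Together these have at most D + 2
   components, the extra one coming from [j]. *)
have := sum_tdist_omit s'.
have : \sum_(k < D.+1) 2 * D.-1 * #|T| <=
    \sum_(k < D.+1) (tdist (omit s' k) + 2 * D.-1 * (1 + (k == j))).
  apply: leq_sum => k _; apply: leq_trans (omit_bound s' k _) _; first by lia.
  by rewrite leq_add2l leq_mul2l omit_k orbT.
have -> : \sum_(k < D.+1) (tdist (omit s' k) + 2 * D.-1 * (1 + (k == j))) =
    \sum_(k < D.+1) tdist (omit s' k) + 2 * D.-1 * D.+2.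
  rewrite big_split /= -big_distrr /=; congr (_ + _ * _); rewrite big_split /= sum_nat_const card_ord.
  by rewrite (bigD1 j) //= eqxx big1 => [|k /negbTE->//]; lia.
rewrite sum_nat_const card_ord.
have le_t : tdist s' + 2 * D <= 2 * D * #|T| by move: (leq_trans am rge); lia.
set U := \sum_k _ => le_U eq_U.
have U_t : U = D.-1 * tdist s' by have := mulnBl D 1 (tdist s'); rewrite subn1 => ->; lia.
(* After division by D - 1, inserting [le_t] leaves 2 p at most 4. *)
have : D.+1 * (2 * #|T|) <= tdist s' + 2 * D.+2.
  by rewrite -(leq_pmul2l (_ : 0 < D.-1)); [move: le_U; rewrite U_t; nia|lia].
by nia.
Qed.

(** * Colored graphs as families of permutations *)

Import Order.TTheory GRing.Theory Num.Theory.

Lemma ncomp_eq1 (T : finType) (r : rel T) (x0 : T) : connect_sym r ->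
  reflect (forall x y, connect r x y) (ncomp r == 1).
Proof.
move=> sym_r; apply: (iffP eqP) => [r1 x y|conn].
  have /eqP/cards1P[B EB] := r1.
  have cl z : [set y in [set: T] | connect r z y] = B.
    by apply/set1P; rewrite -EB; apply: imset_f.
  by have /setP/(_ y) := etrans (cl x) (esym (cl y)); rewrite !inE /= connect0.
apply/eqP; rewrite eqn_leq (ncomp_gt0 r x0) andbT; apply/card_le1_eqP.
move=> _ _ /imsetP[x _ ->] /imsetP[y _ ->]; apply/setP => z; rewrite !inE /=.
by rewrite !conn.
Qed.

Lemma fcomp_bool (T : finType) (q : bool -> {perm T}) :
  fcomp q = #|porbits (step q false true)|.
Proof.
rewrite /fcomp /ncomp /porbits /equivalence_partition.
congr #|pred_of_set _|; set u := step q false true.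
transitivity (porbit u @: [set: T]); last first.
  by apply/setP => B; apply/imsetP/imsetP => -[x _ ->]; exists x.
apply: eq_imset => x; apply/setP => y; rewrite !inE /=; apply/idP/idP; last first.
  by apply: connect_porbit => z; apply/connect1/steprel_step.
case/connectP => p; elim: p x => [x _ ->|z p IH x /= /andP[xz pz] ey]; first exact: porbit_id.
have := IH z pz ey; rewrite -!eq_porbit_mem => /eqP->; apply/eqP.
have ux a : porbit u (u a) = porbit u a by have := porbit_perm u 1 a; rewrite expg1.
case/existsP: xz => k /existsP[l /eqP <-].
have s1 b a : step q b b a = a by rewrite /step mulVg perm1.
case: k l => [] [] //; rewrite ?s1 // -/u ?ux //.
by rewrite -stepV -/u -[in RHS](permKV u x) ux.
Qed.

Lemma sum_pairs2 (I : finType) (g : {set I} -> nat) :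
  \sum_(k : I) \sum_(l | l != k) g [set k; l] = 2 * \sum_(S : {set I} | #|S| == 2) g S.
Proof.
rewrite pair_big_dep /= (partition_big (fun p => [set p.1; p.2]) (fun S => #|S| == 2)) /=; last first.
  by move=> [k l] /= nlk; rewrite cards2 [k == l]eq_sym nlk.
rewrite big_distrr /=; apply: eq_bigr => S /cards2P[a [b [nab ->]]].
rewrite (eq_bigr (fun=> g [set a; b])) => [|p /andP[_ /eqP->]//].
rewrite sum_nat_const; congr (_ * _).
have <- : #|[set (a, b); (b, a)]| = 2.
  by rewrite cards2 xpair_eqE negb_and nab.
apply: eq_card => -[k l]; rewrite !inE !xpair_eqE unfold_in /=.
apply/andP/orP => [[nlk /eqP E]|[/andP[/eqP-> /eqP->]|/andP[/eqP-> /eqP->]]].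
- have := in_set2 k k l; have := in_set2 l k l; rewrite E !inE !eqxx orbT /=.
  by case/orP=> /eqP El /orP[] /eqP Ek; subst; rewrite ?eqxx in nlk *; auto.
- by rewrite eq_sym.
- by split=> //; rewrite setUC.
Qed.

Section Encoding.

Variables (D : nat) (G : colored_graph D).
Implicit Types (b x y z : black G) (w : white G) (e : edge G).
Implicit Types (k l : 'I_D.+1) (S : {set 'I_D.+1}).

Lemma bedge_subproof b k : exists e, (bend e == b) && (color e == k).
Proof.
have /eqP/cards1P[e /setP/(_ e)] := black_regular b k.
by rewrite !inE eqxx => be; exists e.
Qed.

Lemma wedge_subproof w k : exists e, (wend e == w) && (color e == k).
Proof.
have /eqP/cards1P[e /setP/(_ e)] := white_regular w k.
by rewrite !inE eqxx => be; exists e.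
Qed.

Definition bedge b k := xchoose (bedge_subproof b k).
Definition wedge w k := xchoose (wedge_subproof w k).

Lemma bend_bedge b k : bend (bedge b k) = b.
Proof. by have /andP[/eqP] := xchooseP (bedge_subproof b k). Qed.

Lemma color_bedge b k : color (bedge b k) = k.
Proof. by have /andP[_ /eqP] := xchooseP (bedge_subproof b k). Qed.

Lemma wend_wedge w k : wend (wedge w k) = w.
Proof. by have /andP[/eqP] := xchooseP (wedge_subproof w k). Qed.

Lemma color_wedge w k : color (wedge w k) = k.
Proof. by have /andP[_ /eqP] := xchooseP (wedge_subproof w k). Qed.

Lemma edge_black_inj e e' : bend e = bend e' -> color e = color e' -> e = e'.
Proof.
move=> be ce; have /eqP/cards1P[f F] := black_regular (bend e) (color e).
by transitivity f; [|apply: esym]; apply/set1P; rewrite -F inE ?be ?ce !eqxx.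
Qed.

Lemma edge_white_inj e e' : wend e = wend e' -> color e = color e' -> e = e'.
Proof.
move=> be ce; have /eqP/cards1P[f F] := white_regular (wend e) (color e).
by transitivity f; [|apply: esym]; apply/set1P; rewrite -F inE ?be ?ce !eqxx.
Qed.

Definition white_of z : white G := wend (bedge z ord0).

Lemma white_of_inj : injective white_of.
Proof.
move=> x y /edge_white_inj; rewrite !color_bedge => /(_ erefl) /(congr1 (@bend _ G)).
by rewrite !bend_bedge.
Qed.

Lemma white_of_surj w : exists z, white_of z = w.
Proof.
exists (bend (wedge w ord0)); rewrite /white_of -[RHS](wend_wedge w ord0); congr wend.
by apply: edge_black_inj; rewrite ?bend_bedge ?color_bedge ?color_wedge.
Qed.

Definition nbr k z : black G := bend (wedge (white_of z) k).

Lemma nbr_inj k : injective (nbr k).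
Proof.
move=> x y /edge_black_inj; rewrite !color_wedge => /(_ erefl) /(congr1 (@wend _ G)).
by rewrite !wend_wedge => /white_of_inj.
Qed.

(* White vertices are identified with black ones along color [0]; [colperm k] then
   sends a white vertex to its black neighbour of color [k]. *)
Definition colperm k : {perm black G} := perm (@nbr_inj k).

Lemma colpermE e z : wend e = white_of z -> colperm (color e) z = bend e.
Proof.
move=> we; rewrite permE /nbr; congr bend.
by apply: edge_white_inj; rewrite ?wend_wedge ?color_wedge.
Qed.

Lemma step_colperm e e' : wend e = wend e' ->
  step colperm (color e) (color e') (bend e) = bend e'.
Proof.
move=> we; have [z zE] := white_of_surj (wend e).
by rewrite -(colpermE (esym zE)) /step permM permK colpermE // -we.
Qed.

Lemma card_white : #|white G| = #|black G|.
Proof.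
apply/esym/(@bij_eq_card _ _ white_of)/inj_card_bij; first exact: white_of_inj.
rewrite -(card_imset predT white_of_inj) -cardsT subset_leq_card //.
by apply/subsetP => w _; have [z <-] := white_of_surj w; apply: imset_f.
Qed.

Lemma half_orderE : half_order G = #|black G|.
Proof. by rewrite /half_order card_sum card_white addnn doubleK. Qed.

Lemma adj_sym S : symmetric (@adj D G S).
Proof.
by move=> u v; apply/existsP/existsP => -[e /andP[eS h]]; exists e; rewrite eS /= orbC andbC [X in _ || X]andbC.
Qed.

Lemma adj_edge S e : color e \in S -> adj S (bvertex e) (wvertex e).
Proof. by move=> eS; apply/existsP; exists e; rewrite eS !eqxx. Qed.

(** The enumeration [f] of [S] serves all colors, all but one, and two colors (faces). The color
    [f j0] links every white vertex to a black one. *)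
Lemma card_bubbles (J : finType) (f : J -> 'I_D.+1) (S : {set 'I_D.+1}) (j0 : J) :
  (forall k, reflect (exists j, k = f j) (k \in S)) ->
  #|bubbles G S| = fcomp (fun j => colperm (f j)).
Proof.
move=> SP; set q := fun j => colperm (f j).
have symS := sym_connect_sym (@adj_sym S).
have symq := sym_connect_sym (steprel_sym q).
have fS j : f j \in S by apply/SP; exists j.
apply/esym; apply: (ncomp_surj (f := inl) symq symS) => [x y|[x|w]]; last first.
- exists (bend (wedge w (f j0))); rewrite symS; apply: connect1.
  by have := @adj_edge S (wedge w (f j0)); rewrite /wvertex wend_wedge color_wedge; apply.
- by exists x.
apply/idP/idP.
  apply: (connect_homo (f := inl)) => {}x {}y /existsP[j /existsP[l /eqP <-]].
  pose e := bedge x (f j); pose e' := wedge (wend e) (f l).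
  have -> : step q j l x = bend e'.
    have := @step_colperm e e'; rewrite wend_wedge color_bedge color_wedge bend_bedge; exact.
  have e1 : adj S (inl x) (wvertex e).
    by have := @adj_edge S e; rewrite /bvertex bend_bedge color_bedge; apply.
  have e2 : adj S (wvertex e) (inl (bend e')).
    have := @adj_edge S e'; rewrite adj_sym /wvertex wend_wedge color_wedge; exact.
  exact: connect_trans (connect1 e1) (connect1 e2).
(* Paths are retracted to black vertices by sending a white vertex to its neighbor of color
   [f j0]. *)
pose g (u : vertex G) := match u with inl x => x | inr w => bend (wedge w (f j0)) end.
rewrite -[in X in _ -> X]/(connect (steprel q) (g (inl x)) (g (inl y))).
apply: (connect_homo (f := g)) => {x y} u v /existsP[e /andP[/SP[j eE] uv]].
have h : connect (steprel q) (bend e) (bend (wedge (wend e) (f j0))).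
  have := @step_colperm e (wedge (wend e) (f j0)); rewrite wend_wedge color_wedge eE => /(_ erefl) <-.
  by apply: connect1; exact: (steprel_step q).
by case/orP: uv => /andP[/eqP-> /eqP->] //=; rewrite symq.
Qed.

Lemma card_bubblesT : #|bubbles G [set: 'I_D.+1]| = fcomp colperm.
Proof.
by apply: (@card_bubbles _ id _ ord0) => k; rewrite inE; apply: ReflectT; exists k.
Qed.

Lemma card_bubbles_hat k : 0 < D -> #|bubbles G (~: [set k])| = fcomp (omit colperm k).
Proof.
move=> D_gt0; apply: (@card_bubbles _ (@lift D.+1 k) _ (Ordinal D_gt0)) => l.
rewrite !inE; apply: (iffP idP) => [|[j ->]]; last by rewrite eq_sym neq_lift.
by rewrite eq_sym => kl; have [j] := unlift_some kl; exists j.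
Qed.

Lemma card_faces k l : k != l -> #|bubbles G [set k; l]| = #|porbits (step colperm k l)|.
Proof.
move=> nkl; rewrite (@card_bubbles _ (fun b : bool => if b then l else k) _ true) ?fcomp_bool //.
move=> i; rewrite !inE; apply: (iffP orP) => [[]/eqP->|[[] ->]]; last 2 first.
- by right.
- by left.
- by exists false.
- by exists true.
Qed.

(** For each ordered pair of distinct colors, faces and distance add up to p. *)
Lemma nfacesE : 2 * nfaces G + tdist colperm = D.+1 * D * #|black G|.
Proof.
rewrite /nfaces -sum_pairs2 /tdist -big_split /=.
rewrite (eq_bigr (fun=> D * #|black G|)) => [|k _]; first by rewrite sum_nat_const card_ord mulnA.
rewrite [X in _ + X](bigD1 k) //= distxx add0n -big_split /=.
rewrite (eq_bigr (fun=> #|black G|)) => [|l nlk].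
  by rewrite sum_nat_const; congr (_ * _); rewrite cardC1 card_ord.
rewrite card_faces 1?eq_sym // /dist /tlen.
by rewrite subnKC // card_porbits_le.
Qed.

Lemma degreeE : (degree G * 4 =
  (D.-1)`!%:R * ((tdist colperm)%:R + 2 * D%:R - 2 * D%:R * #|black G|%:R))%R.
Proof.
have := congr1 (fun n => n%:R : rat)%R nfacesE.
rewrite natrD !natrM /degree half_orderE -[(D.+1)%:R%R]natr1 => E.
have -> : ((nfaces G)%:R = ((D%:R + 1) * D%:R * #|black G|%:R - (tdist colperm)%:R) / 2 :> rat)%R.
  by rewrite -E; field.
by field.
Qed.

End Encoding.

Lemma coreP D (G : colored_graph D) : 0 < D ->
  core G <-> fcomp (colperm G) = 1 /\ forall k, fcomp (omit (colperm G) k) = 1.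
Proof.
move=> D_gt0; rewrite /core /connected card_bubblesT; split=> [[conn nodip]|[conn conn_omit]].
  split=> // k; apply/eqP; rewrite eqn_leq; apply/andP; split; last first.
    by rewrite -conn; exact: fcomp_omit.
  rewrite -card_bubbles_hat // -conn -card_bubblesT.
  have symT := sym_connect_sym (@adj_sym D G [set: 'I_D.+1]).
  have symk := sym_connect_sym (@adj_sym D G (~: [set k])).
  apply: (ncomp_sub symT symk) => u v /existsP[e /andP[_ uv]].
  (* An edge of color [k] that is no 1-dipole can be bypassed by the other colors. *)
  have conn_e : connect (@adj D G (~: [set k])) (bvertex e) (wvertex e).
    have [ke|ke] := eqVneq (color e) k.
      by rewrite -ke; apply/negPn/negP => dip; apply: nodip; exists e.
    by apply/connect1/adj_edge; rewrite !inE.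
  by case/orP: uv => /andP[/eqP-> /eqP->] //; rewrite symk.
split=> // -[e /negP]; apply.
have symk := sym_connect_sym (@adj_sym D G (~: [set color e])).
by apply: (elimT (ncomp_eq1 (bvertex e) symk)); rewrite -[ncomp _]/(#|bubbles G _|) card_bubbles_hat ?conn_omit.
Qed.

(** * Recognizing the two-dipole graphs and computing their degree *)

Section TwoDipoleForm.

Variables (D : nat) (G : colored_graph D) (i0 i1 : 'I_D.+1).

(** An edge is determined by its black end and color, so the vertex bijections determine the edge
    map. *)
Lemma isomorphic_two_dipole :
  isomorphic G (two_dipole_graph i0 i1) <->
  exists (fb : black G -> bool) (fw : white G -> bool),
    [/\ bijective fb, bijective fw &
     forall e, fw (wend e) = fb (bend e) (+) (color e \in [set i0; i1])].
Proof.
have twE b k : two_dipole_wend i0 i1 (b, k) = b (+) (k \in [set i0; i1]).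
  by rewrite /two_dipole_wend; case: (_ \in _); case: b.
split=> [[fb [fw [fe [[bb bw _] iso]]]]|[fb [fw [bb bw iso]]]].
  exists fb, fw; split=> // e; have [<- <- <-] := iso e.
  by rewrite -twE /= /color /=; case: (fe e).
have [gb fbK gbK] := bb.
exists fb, fw, (fun e => (fb (bend e), color e)); split; last first.
  by move=> e; split; rewrite //= twE iso.
split=> //; exists (fun p => bedge (gb p.1) p.2) => [e|[b k]] /=; last first.
  by rewrite bend_bedge color_bedge gbK.
by apply: edge_black_inj; rewrite ?bend_bedge ?color_bedge ?fbK.
Qed.

Lemma two_dipole_isomorphic z a : #|black G| = 2 ->
    i0 != i1 -> colperm G i0 z != a -> colperm G i1 z != a ->
    (forall k, k != i0 -> k != i1 -> colperm G k z = a) ->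
  isomorphic G (two_dipole_graph i0 i1).
Proof.
move=> B2 ni z0 z1 zk; have W2 : #|white G| = 2 by rewrite card_white.
have inj2 (T : finType) (c : T) : #|T| = 2 -> bijective (eq_op^~ c).
  move=> T2; apply: inj_card_bij; last by rewrite T2 card_bool.
  move=> x y; have [->|xc] := eqVneq x c; first by move=> /esym/eqP ->.
  move=> /esym/negbT yc; apply/eqP; apply: contraT => nxy.
  have : #|[set x; y; c]| <= 2 by rewrite -T2 max_card.
  by rewrite setUC cardsU1 cards2 !inE negb_or nxy eq_sym xc eq_sym yc.
(* With two vertices of each kind, testing for [a] and for the white vertex of [z] gives the
   bijections with [bool]. *)
apply/isomorphic_two_dipole; exists (eq_op^~ a), (eq_op^~ (white_of z)); split; try exact: inj2.
have pat k : (colperm G k z == a) = (k \notin [set i0; i1]).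
  rewrite !inE negb_or; have [->|k0] := eqVneq k i0; first exact: negbTE.
  by have [->|k1] := eqVneq k i1; [exact: negbTE|rewrite zk // eqxx].
move=> e; have [we|nwe] := eqVneq (wend e) (white_of z).
  by rewrite -(colpermE we) pat; case: (_ \in _).
have nbe : bend e != colperm G (color e) z.
  apply: contra nwe; rewrite permE => /eqP/edge_black_inj; rewrite color_wedge => /(_ erefl) ->.
  by rewrite wend_wedge.
have := pat (color e); have [ba|nba] := eqVneq (bend e) a.
  by rewrite -ba eq_sym (negbTE nbe) => /esym/negbFE ->.
have [_|nca] := eqVneq (colperm G (color e) z) a; first by move=> /esym/negbTE ->.
have : #|[set bend e; colperm G (color e) z; a]| <= 2 by rewrite -B2 max_card.
by rewrite setUC cardsU1 cards2 !inE negb_or nbe eq_sym nba eq_sym nca.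
Qed.

Hypothesis hD : 3 <= D.
Hypothesis ni : i0 != i1.
Hypothesis iso : isomorphic G (two_dipole_graph i0 i1).

Let P := [set i0; i1].

Lemma two_dipole_card : #|black G| = 2.
Proof.
by have [fb [fw [bb _ _]]] := (isomorphic_two_dipole.1 iso); rewrite (bij_eq_card bb) card_bool.
Qed.

(** The term in [ord0] stems from identifying white with black vertices along color 0. *)
Lemma two_dipole_colperm : exists2 fb : black G -> bool, bijective fb &
  forall k z, fb (colperm G k z) = fb z (+) (ord0 \in P) (+) (k \in P).
Proof.
have [fb [fw [bb _ fbw]]] := (isomorphic_two_dipole.1 iso); exists fb => // k z.
have := fbw (bedge z ord0); rewrite -/(white_of z) bend_bedge color_bedge => <-.
have := fbw (wedge (white_of z) k); rewrite wend_wedge color_wedge permE => ->.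
by rewrite -addbA addbb addbF.
Qed.

Lemma two_dipole_step k l x : (step (colperm G) k l x != x) = ((k \in P) != (l \in P)).
Proof.
have [fb bb fbE] := two_dipole_colperm.
rewrite -(inj_eq (bij_inj bb)) /step permM -{2}(permKV (colperm G k) x) !fbE.
by case: (fb _); case: (ord0 \in P); case: (k \in P); case: (l \in P).
Qed.

Lemma two_dipole_dist k l : dist (colperm G) k l = ((k \in P) != (l \in P)).
Proof.
have /card_gt0P[x0 _] : 0 < #|black G| by rewrite two_dipole_card.
case E : (_ != _).
  have le_dist : dist (colperm G) k l <= 1.
    rewrite /dist /tlen two_dipole_card leq_subLR addn1 ltnS.
    by apply/card_gt0P; exists (porbit (step (colperm G) k l) x0); apply: imset_f.
  have := card_moved (step (colperm G) k l); rewrite -/(dist _ k l).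
  have -> : [set x | step (colperm G) k l x != x] = setT.
    by apply/setP => x; rewrite !inE two_dipole_step E.
  by rewrite cardsT two_dipole_card; move: le_dist; case: (dist _ _ _) => [|[|?]].
rewrite /dist (_ : step _ k l = 1%g) ?tlen1 //; apply/permP => x; rewrite perm1.
by apply/eqP; rewrite -[_ == _]negbK two_dipole_step E.
Qed.

(** The 2 (D - 1) pairs of colors separated by [P] have distance 1, the others 0; both orders
    count. *)
Lemma two_dipole_tdist : tdist (colperm G) = 4 * D.-1.
Proof.
have cP : #|P| = 2 by rewrite cards2 ni.
have cC : #|~: P| = D.-1 by have := cardsC P; rewrite cP card_ord; lia.
have zero (A B : pred 'I_D.+1) : (forall k l, A k -> B l -> (k \in P) = (l \in P)) ->
    \sum_(k | A k) \sum_(l | B l) dist (colperm G) k l = 0.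
  move=> AB; apply: big1 => k Ak; apply: big1 => l Bl.
  by rewrite two_dipole_dist (AB k l Ak Bl) eqxx.
have zero_in : \sum_(k in P) \sum_(l in P) dist (colperm G) k l = 0 by apply: zero => k l -> ->.
have zero_out : \sum_(k | k \notin P) \sum_(l | l \notin P) dist (colperm G) k l = 0.
  by apply: zero => k l /negbTE-> /negbTE->.
rewrite (tdist_split _ P) zero_in zero_out.
rewrite (eq_bigr (fun=> 2)) => [|k /negbTE kP].
  rewrite sum_nat_const (eq_card (_ : _ =i ~: P)) ?cC; last by move=> k; rewrite in_setC.
  by lia.
rewrite -[RHS]cP -sum1_card; apply: eq_bigr => l lP.
by rewrite two_dipole_dist kP lP.
Qed.

(** After omitting any color, one in [P] and one outside remain, and their step exchanges the two
    black vertices. *)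
Lemma two_dipole_fcomp : fcomp (colperm G) = 1 /\ forall k, fcomp (omit (colperm G) k) = 1.
Proof.
have /card_gt0P[x0 _] : 0 < #|black G| by rewrite two_dipole_card.
suff conn k : fcomp (omit (colperm G) k) <= 1.
  have le k := fcomp_omit (colperm G) k.
  have gt0 : 0 < fcomp (colperm G) by exact: (ncomp_gt0 _ x0).
  split=> [|k]; last by have := le k; have := conn k; lia.
  by have := le ord0; have := conn ord0; lia.
have [m mk mP] : exists2 m, m != k & m \in P.
  have [<-|i0k] := eqVneq i0 k; first by exists i1; rewrite ?inE ?eqxx ?orbT // eq_sym.
  by exists i0; rewrite ?inE ?eqxx.
have [l lk lP] : exists2 l, l != k & l \notin P.
  have : 0 < #|~: (k |: P)|.
    have := cardsC (k |: P); rewrite card_ord cardsU1 cards2 ni.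
    by case: (_ \notin _) => /=; lia.
  by case/card_gt0P => l; rewrite in_setC in_setU1 negb_or => /andP[]; exists l.
rewrite eq_sym in mk; rewrite eq_sym in lk.
have [[m' mE _] [l' lE _]] := (unlift_some mk, unlift_some lk).
rewrite leq_eqVlt; apply/orP; left.
apply/(ncomp_eq1 x0 (sym_connect_sym (steprel_sym _))) => x y.
have [->|nxy] := eqVneq x y; first exact: connect0.
suff -> : y = step (omit (colperm G) k) m' l' x by apply/connect1/steprel_step.
have : step (colperm G) m l x != x by rewrite two_dipole_step mP (negbTE lP).
rewrite mE lE -[step _ _ _]/(step (omit (colperm G) k) m' l') => nsx.
apply/eqP; apply: contraT => nys.
have : #|[set x; y; step (omit (colperm G) k) m' l' x]| <= 2 by rewrite -two_dipole_card max_card.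
by rewrite setUC cardsU1 cards2 !inE negb_or nxy nsx eq_sym nys.
Qed.

End TwoDipoleForm.

(** * The smallest positive degree and its core graphs *)

Lemma isomorphic_refl D (G : colored_graph D) : isomorphic G G.
Proof. by exists id, id, id; split=> //; split; exists id. Qed.

Theorem proposition3p1 (D : nat) (hD : (3 <= D)%N) :
  exists w : rat,
    is_NLO_degree D w /\
    forall G : colored_graph D,
      (core G /\ degree G = w) <->
      (exists i0 i1 : 'I_D.+1,
         i0 != i1 /\ isomorphic G (two_dipole_graph i0 i1)).
Proof.
have D_gt0 : 0 < D by lia.
(* The value at 2 Delta = 2 (D - 2), since the degree is (D - 1)! / 4 times 2 Delta. *)
pose w : rat := ((D.-1)`!%:R * (2 * (D - 2)%:R) / 4)%R.
have f_gt0 : (0 < (D.-1)`!%:R :> rat)%R by rewrite ltr0n fact_gt0.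
have degP (G : colored_graph D) : (degree G =
    (D.-1)`!%:R * ((tdist (colperm G))%:R + 2 * D%:R - 2 * D%:R * #|black G|%:R) / 4)%R.
  by rewrite -degreeE; field.
have deg_nat (G : colored_graph D) c : degree G = ((D.-1)`!%:R * c%:R / 4)%R <->
    tdist (colperm G) + 2 * D = 2 * D * #|black G| + c.
  rewrite degP; split=> [E|/(congr1 (fun n => n%:R : rat)%R)]; last first.
    by rewrite !natrD !natrM => E; congr (_ * _ / _)%R; lra.
  apply/eqP; rewrite -(eqr_nat rat) !natrD !natrM; apply/eqP.
  have /(mulfI (lt0r_neq0 f_gt0)) : ((D.-1)`!%:R * ((tdist (colperm G))%:R + 2 * D%:R - 2 * D%:R * #|black G|%:R)
     = (D.-1)`!%:R * c%:R :> rat)%R by lra.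
  lra.
have wE : w = ((D.-1)`!%:R * (2 * (D - 2))%:R / 4)%R by rewrite /w natrM.
have dipole_deg (G : colored_graph D) i0 i1 : i0 != i1 -> isomorphic G (two_dipole_graph i0 i1) ->
    core G /\ degree G = w.
  move=> ni iso; split; first by apply/(coreP G D_gt0); exact: two_dipole_fcomp hD ni iso.
  by rewrite wE; apply/deg_nat; rewrite (two_dipole_tdist hD ni iso) (two_dipole_card iso); lia.
exists w; split.
  split.
  - have D2 : 0 < 2 * (D - 2) by lia.
    by rewrite wE divr_gt0 // mulr_gt0 // ltr0n.
  - have ni : ord0 != ord_max :> 'I_D.+1 by rewrite -val_eqE /=; lia.
    have [[conn _] deg] := dipole_deg _ _ _ ni (isomorphic_refl _).
    by exists (two_dipole_graph ord0 ord_max).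
  move=> G; rewrite /connected card_bubblesT => conn; rewrite degP wE => pos.
  rewrite ler_pM2r ?invr_gt0 // ler_pM2l //.
  have : (0 < (tdist (colperm G))%:R + 2 * D%:R - 2 * D%:R * #|black G|%:R :> rat)%R.
    by move: pos; rewrite -mulrA pmulr_rgt0 // pmulr_lgt0.
  rewrite subr_gt0 lerBrDr -!natrM -!natrD ltr_nat ler_nat => lt.
  rewrite leqNgt; apply/negP => small.
  (* Below [w], the gap forces Delta = 0, contradicting positivity. *)
  by have := degree_gap (s := colperm G) hD; rewrite conn; lia.
move=> G; split=> [[/(coreP G D_gt0)[conn conn_omit]]|[i0 [i1 [ni iso]]]]; last exact: dipole_deg iso.
rewrite wE => /deg_nat deg.
have [B2 [z [a [i [j [nij ia ja others]]]]]] := core_gap hD conn conn_omit deg.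
by exists i, j; split=> //; exact: two_dipole_isomorphic others.
Qed.
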